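(* Let $\lambda=0$. Suppose that $n$ is an integer with $1\le n\le q$ such that $F_i(x,y)\equiv0$ and $G_i(x,y)\equiv 0$ for all $i<n$, and such that $G_{n+l}(0,0)=0$ for all $0\le l<n$ and $$G_{2n}(0,0)-F_n(0,0)\big(\partial_yG_n(0,0)+\delta_{n,q}\big)\neq0.$$ Put $$\Delta_n=\big(\partial_xG_n(0,0)\big)^2-4w(0)\Big(\big(\partial_yG_n(0,0)+\delta_{n,q}\big)F_n(0,0)-G_{2n}(0,0)\Big),$$ suppose $\Delta_n>0$, and put $\nu_-=\frac{1}{2w(0)}\big(\partial_xG_n(0,0)-\sqrt{\Delta_n}\big)$. Let $x_\ast(t),y_\ast(t)$ be the solution of the perturbed system $$\frac{dx}{dt}=\partial_y H(x,y;\lambda)+F(x,y,t),\qquad \frac{dy}{dt}=-\partial_x H(x,y;\lambda)+G(x,y,t)$$ with asymptotics $$x_\ast(t)=\sum_{k=n}^{\infty}t^{-\frac{k}{q}}x_k,\qquad y_\ast(t)=\sum_{k=n}^{\infty}t^{-\frac{k}{q}}y_k,\qquad t\to\infty,$$ where $x_k,y_k$ are real constants and $x_n=\nu_-$. Then the solution $x_\ast(t),y_\ast(t)$ is unstable.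
   Context: Standing setting. The functions $H(x,y;\lambda)$, $F(x,y,t)$, $G(x,y,t)$ are smooth for all $(x,y)\in\mathbb R^2$, $t>0$, $\lambda\in\mathbb R$. The Hamiltonian of the limiting system is $H(x,y;\lambda)=\frac{y^2}{2}+V(x;\lambda)$ with $\partial_xV(x;\lambda)=(x^2-\lambda)w(x)$, where, for some $d_0>0$, $w(x)>0$ for all $(x,\lambda)\in\{|x|<\sqrt\lambda+d_0,\ \lambda\ge 0\}\cup\{|x|<d_0,\ \lambda<0\}$. The perturbations satisfy $F(x,y,t)\to0$ and $G(x,y,t)\to0$ as $t\to\infty$ for $(x,y)$ in any compact subset of $\mathbb R^2$, and have power-law asymptotics $$F(x,y,t)=\sum_{k=1}^\infty t^{-\frac kq}F_k(x,y),\qquad G(x,y,t)=\sum_{k=1}^\infty t^{-\frac kq}G_k(x,y),\qquad t\to\infty,$$ where $q$ is a positive integer and $F_k,G_k$ are smooth functions on $\mathbb R^2$. Infinite series followed by ''$t\to\infty$'' are understood as asymptotic expansions. The coefficients $x_k,y_k$ of the solution's expansion are those obtained by substituting the series into the system and equating the coefficients of equal powers of $t$. $\delta_{n,q}$ is the Kronecker delta. Stability and instability of a solution are understood in the sense of Lyapunov, as $t\to\infty$.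
   Formalization: The expansions of F and G are assumed uniform on compact sets and valid also for the first partial derivatives in x and y (termwise differentiation); with expansions of the values alone the claim fails, since a flat remainder can stabilize the solution. *)

(* Defs.v *)
From Stdlib Require Import Reals.
From Coquelicot Require Import Coquelicot.
Open Scope R_scope.

Definition partial1 (f : R -> R -> R -> R) (x y z : R) : R := Derive (fun u => f u y z) x.
Definition partial2 (f : R -> R -> R -> R) (x y z : R) : R := Derive (fun u => f x u z) y.
Definition partial3 (f : R -> R -> R -> R) (x y z : R) : R := Derive (fun u => f x y u) z.

Definition partial_x (g : R -> R -> R) (x y : R) : R := Derive (fun u => g u y) x.
Definition partial_y (g : R -> R -> R) (x y : R) : R := Derive (fun u => g x u) y.

Definition smooth2 (g : R -> R -> R) : Prop :=
  forall (n : nat) (x y : R), ex_diff_n g n x y.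

(* The analogue of [ex_diff_n] for three variables on an open set D: all
   iterated partial derivatives up to order n exist and are jointly continuous
   on D. *)
Fixpoint ex_diff3_n (D : R -> R -> R -> Prop) (n : nat)
    (f : R -> R -> R -> R) {struct n} : Prop :=
  (forall x y z, D x y z ->
     continuous (fun p : R * R * R => f (fst (fst p)) (snd (fst p)) (snd p))
                (x, y, z)) /\
  match n with
  | O => True
  | S m =>
      (forall x y z, D x y z ->
         ex_derive (fun u => f u y z) x /\
         ex_derive (fun u => f x u z) y /\
         ex_derive (fun u => f x y u) z) /\
      ex_diff3_n D m (partial1 f) /\ ex_diff3_n D m (partial2 f) /\ ex_diff3_n D m (partial3 f)
  end.

Definition smooth3_on (D : R -> R -> R -> Prop) (f : R -> R -> R -> R) : Prop :=
  forall n : nat, ex_diff3_n D n f.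

(* Asymptotic expansion  f(t) = sum_{k >= m} t^{-k/q} a_k  as t -> infinity. *)
Definition power_expansion (q m : nat) (f : R -> R) (a : nat -> R) : Prop :=
  forall N : nat,
    is_lim (fun t => Rpower t (INR N / INR q) *
                     (f t - sum_n_m (fun k => Rpower t (- (INR k / INR q)) * a k) m N))
           p_infty 0.

(* Convergence as t -> infinity, uniform on compact subsets of R^2; it is enough
   to consider the squares |x|, |y| <= r. *)
Definition tends_to_zero_loc_unif (f : R -> R -> R -> R) : Prop :=
  forall r eps : R, 0 < eps ->
    exists T : R, 0 < T /\
      forall x y t : R, Rabs x <= r -> Rabs y <= r -> T < t ->
        Rabs (f x y t) < eps.

Definition loc_unif_power_expansion (q : nat) (f : R -> R -> R -> R)
    (fk : nat -> R -> R -> R) : Prop :=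
  forall N : nat,
    tends_to_zero_loc_unif (fun x y t =>
      Rpower t (INR N / INR q) *
      (f x y t - sum_n_m (fun k => Rpower t (- (INR k / INR q)) * fk k x y) 1 N)).

(* Expansions of functions of (x,y,t) hold in the C^1 sense in (x,y), i.e. they
   may be differentiated once termwise in x and in y.  Expansions of the values
   alone do not determine the linearization at a solution: a term such as
   exp(-t) sin(x exp(5t)) is smooth and has zero expansion, while its
   x-derivative is unbounded. *)
Definition C1_power_expansion (q : nat) (f : R -> R -> R -> R)
    (fk : nat -> R -> R -> R) : Prop :=
  loc_unif_power_expansion q f fk /\
  loc_unif_power_expansion q (partial1 f) (fun k => partial_x (fk k)) /\
  loc_unif_power_expansion q (partial2 f) (fun k => partial_y (fk k)).

(* Solution on [t0, +oo).  Only the values on [t0, +oo) matter: the two-sided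
   derivative at t0 is no restriction, as a solution differentiable from the
   right at t0 extends affinely to the left of t0. *)
Definition is_solution (H : R -> R -> R -> R) (lam : R)
    (F G : R -> R -> R -> R) (t0 : R) (x y : R -> R) : Prop :=
  forall t : R, t0 <= t ->
    is_derive x t (partial2 H (x t) (y t) lam + F (x t) (y t) t) /\
    is_derive y t (- partial1 H (x t) (y t) lam + G (x t) (y t) t).

(* Lyapunov stability of a solution given on [t0, +oo): for every initial time
   tau >= t0 and every eps > 0 there is delta > 0 such that the solution with
   initial data at tau less than delta away is defined on [tau, +oo) and stays
   less than eps away.  The right-hand sides are smooth, so this solution is
   unique, and the choice of tau is immaterial by continuous dependence on the
   initial data.  Solutions that blow up in finite time violate the condition. *)
Definition lyapunov_stable (H : R -> R -> R -> R) (lam : R)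
    (F G : R -> R -> R -> R) (t0 : R) (xs ys : R -> R) : Prop :=
  forall tau eps : R, t0 <= tau -> 0 < eps ->
    exists delta : R, 0 < delta /\
      forall a b : R, dist_euc a b (xs tau) (ys tau) < delta ->
        exists x y : R -> R,
          is_solution H lam F G tau x y /\ x tau = a /\ y tau = b /\
          forall t : R, tau <= t -> dist_euc (x t) (y t) (xs t) (ys t) < eps.

Definition lyapunov_unstable (H : R -> R -> R -> R) (lam : R)
    (F G : R -> R -> R -> R) (t0 : R) (xs ys : R -> R) : Prop :=
  ~ lyapunov_stable H lam F G t0 xs ys.

Definition kronecker (i j : nat) : R := if Nat.eqb i j then 1 else 0.

Definition Delta_n (w : R -> R) (q n : nat) (Fk Gk : nat -> R -> R -> R) : R :=
  (partial_x (Gk n) 0 0) ^ 2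
  - 4 * w 0 * ((partial_y (Gk n) 0 0 + kronecker n q) * Fk n 0 0 - Gk (2 * n)%nat 0 0).

Definition nu_minus (w : R -> R) (q n : nat) (Fk Gk : nat -> R -> R -> R) : R :=
  1 / (2 * w 0) * (partial_x (Gk n) 0 0 - sqrt (Delta_n w q n Fk Gk)).

(* Main.v *)
Require Import Defs.
From Stdlib Require Import Reals Lra Lia.
From Coquelicot Require Import Coquelicot.
Open Scope R_scope.

(** Write [p = xs - x] and [r = ys - y] for the deviation of a solution from the
    reference solution, [alpha = n/q] and [s = t^(-alpha)].  At the leading order
    the linearization is [p' = r], [r' = kappa s p]: the potential contributes
    [-2 w(0) xs p], which is about [-2 w(0) nu s p], the perturbation contributes
    [d_x G_n(0,0) s p], and the choice of [nu_-] makes the sum of the two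
    coefficients equal to [kappa = sqrt Delta_n > 0].  So the solution is a saddle
    with exponents about [+- sqrt(kappa s)].  The other linear terms are small
    corrections: [p] enters [r'] with an error that is a small fraction of
    [kappa s], and the remaining coefficients are of order [s], hence negligible
    against [sqrt s].

    The linear part alone does not settle the matter, because the quadratic term
    of the potential is comparable with [s p] as soon as [p] is of order [s], and
    this scale shrinks to zero.  In the quadrant [p > 0, r > 0], however, that
    term has a favourable sign: deviating to the left of [xs], it adds
    [w(0) p^2 > 0] to [r'].  Hence in a fixed small box, and for all late times,
    [p' = r + A p + B r] with [A, B = O(s)] and
    [r' >= (kappa/2) s p - C s r] ([leading_increment], [force_increment]).

    Chetaev's function [W = p r] then satisfies [W' >= s W] for small [s]: up to
    terms of order [s p r], its derivative is at least
    [r^2/2 + (kappa/2) s p^2], and this form beats them since it is at least of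
    order [sqrt s p r] ([saddle_product_rate]).  As [alpha <= 1], [s >= 1/t], so [W/t] does not
    decrease, the trajectory cannot leave the quadrant, and [W] grows at least
    linearly ([chetaev_growth]).  This contradicts a bound on [p] and [r]
    ([saddle_escape]), however small the initial deviation. *)

(** * One-variable calculus *)

Lemma mean_value (f df : R -> R) (a b : R) :
  (forall u, Rmin a b <= u <= Rmax a b -> is_derive f u (df u)) ->
  exists c, Rmin a b <= c <= Rmax a b /\ f b - f a = df c * (b - a).
Proof.
  intros Hd. apply MVT_gen.
  - intros u Hu. apply Hd. lra.
  - intros u Hu. apply continuity_pt_filterlim.
    apply (ex_derive_continuous f). exists (df u). now apply Hd.
Qed.

Lemma between_abs_le (a b c rho : R) :
  Rabs a <= rho -> Rabs b <= rho -> Rmin a b <= c <= Rmax a b -> Rabs c <= rho.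
Proof.
  intros Ha Hb Hc. apply Rabs_le_between in Ha, Hb. apply Rabs_le_between.
  unfold Rmin, Rmax in Hc. destruct (Rle_dec a b); lra.
Qed.

Lemma nondecreasing_of_derivative (f df : R -> R) (a b : R) :
  a <= b ->
  (forall u, a <= u <= b -> is_derive f u (df u)) ->
  (forall u, a <= u < b -> 0 <= df u) ->
  f a <= f b.
Proof.
  intros Hab Hd Hpos.
  destruct (Req_dec a b) as [->|Hne]; [lra|].
  destruct (MVT_cor2 f df a b) as [c [Hc Hcab]].
  - lra.
  - intros u Hu. apply is_derive_Reals. now apply Hd.
  - assert (0 <= df c) by (apply Hpos; lra).
    assert (0 <= df c * (b - a)) by (apply Rmult_le_pos; lra). lra.
Qed.

Lemma positive_near (f : R -> R) (a : R) :
  ex_derive f a -> 0 < f a ->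
  exists d, 0 < d /\ forall u, Rabs (u - a) < d -> 0 < f u.
Proof.
  intros Hd Hpos.
  assert (Hl : locally (f a) (fun z => 0 < z)) by now apply (open_gt 0).
  destruct (ex_derive_continuous f a Hd _ Hl) as [d Hdel].
  exists d. split; [apply cond_pos|]. intros u Hu. now apply Hdel.
Qed.

Lemma nonneg_at_left_end (f : R -> R) (a T : R) :
  a < T -> ex_derive f T -> (forall u, a <= u < T -> 0 < f u) -> 0 <= f T.
Proof.
  intros HaT Hd Hpos.
  destruct (Rle_or_lt 0 (f T)) as [Hle|Hlt]; [exact Hle|exfalso].
  destruct (positive_near (fun u => - f u) T) as [d [Hd0 Hneg]].
  - now apply (ex_derive_opp f).
  - lra.
  - set (u := Rmax a (T - d / 2)).
    assert (Hu : a <= u < T /\ T - d < u).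
    { unfold u, Rmax. destruct (Rle_dec a (T - d / 2)); lra. }
    assert (0 < f u) by (apply Hpos; tauto).
    assert (0 < - f u) by (apply Hneg; rewrite Rabs_left; lra). lra.
Qed.

(** * Growth in a quadrant *)

(** As long as both functions are positive, [p r / t] has a nonnegative
    derivative.  At the first exit time from the quadrant one of the factors would
    vanish, hence so would this quotient, which is at least its positive initial
    value; so there is no exit and the bound holds for ever. *)
Lemma chetaev_growth (p r dp dr : R -> R) (tau : R) :
  0 < tau -> 0 < p tau -> 0 < r tau ->
  (forall t, tau <= t -> is_derive p t (dp t) /\ is_derive r t (dr t)) ->
  (forall t, tau <= t -> 0 < p t -> 0 < r t ->
     p t * r t / t <= dp t * r t + p t * dr t) ->
  forall t, tau <= t -> p tau * r tau / tau <= p t * r t / t.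
Proof.
  intros Htau Hp0 Hr0 Hder Hineq.
  assert (Hmono : forall b, tau <= b ->
            (forall s, tau <= s < b -> 0 < p s /\ 0 < r s) ->
            p tau * r tau / tau <= p b * r b / b).
  { intros b Hb Hpos.
    apply (nondecreasing_of_derivative (fun t => p t * r t / t)
             (fun t => (dp t * r t + p t * dr t - p t * r t / t) / t) tau b Hb).
    - intros u Hu. destruct (Hder u) as [Hdp Hdr]; [lra|].
      auto_derive.
      + repeat split; try lra; eexists; eassumption.
      + replace (Derive (fun x : R => p x) u) with (dp u)
          by (symmetry; now apply is_derive_unique).
        replace (Derive (fun x : R => r x) u) with (dr u)
          by (symmetry; now apply is_derive_unique).
        field. lra.
    - intros u Hu. destruct (Hpos u Hu) as [Hp Hr].
      apply Rmult_le_pos; [|left; apply Rinv_0_lt_compat; lra].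
      assert (p u * r u / u <= dp u * r u + p u * dr u)
        by (apply Hineq; tauto || lra). lra. }
  intros b Hb. apply Hmono; [exact Hb|].
  (* The supremum [T] of the times up to which the quadrant is not left. *)
  set (E := fun t => tau <= t <= b /\
                     forall s, tau <= s <= t -> 0 < p s /\ 0 < r s).
  assert (HE0 : E tau).
  { split; [lra|]. intros s Hs. replace s with tau by lra. tauto. }
  destruct (completeness E) as [T [Hub Hlub]].
  { exists b. intros t [Ht _]. lra. }
  { now exists tau. }
  assert (HtauT : tau <= T) by now apply Hub.
  assert (HTb : T <= b) by (apply Hlub; intros t [Ht _]; lra).
  assert (Hbelow : forall s, tau <= s < T -> 0 < p s /\ 0 < r s).
  { intros s Hs.
    destruct (Classical_Prop.classic (exists t, E t /\ s <= t))
      as [[t [[Ht Ht'] Hst]]|Hno].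
    - apply Ht'. lra.
    - exfalso. assert (T <= s); [|lra]. apply Hlub. intros t Et.
      destruct (Rle_or_lt t s) as [|Hlt]; [assumption|].
      exfalso. apply Hno. exists t. split; [exact Et|lra]. }
  destruct (Hder T HtauT) as [HdpT HdrT].
  assert (HTpos : 0 < p T /\ 0 < r T).
  { destruct (Req_dec tau T) as [<-|Hne]; [tauto|].
    assert (0 <= p T).
    { apply (nonneg_at_left_end p tau); [lra|now exists (dp T)|].
      intros u Hu. now apply Hbelow. }
    assert (0 <= r T).
    { apply (nonneg_at_left_end r tau); [lra|now exists (dr T)|].
      intros u Hu. now apply Hbelow. }
    assert (HW : 0 < p T * r T / T).
    { apply Rlt_le_trans with (p tau * r tau / tau); [|now apply Hmono].
      apply Rdiv_lt_0_compat; [now apply Rmult_lt_0_compat|lra]. }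
    split.
    - destruct (Req_dec (p T) 0) as [Hzero|]; [|lra].
      rewrite Hzero in HW. unfold Rdiv in HW. lra.
    - destruct (Req_dec (r T) 0) as [Hzero|]; [|lra].
      rewrite Hzero in HW. unfold Rdiv in HW. lra. }
  destruct (positive_near p T) as [d1 [Hd1 Hp1]]; [now exists (dp T)|tauto|].
  destruct (positive_near r T) as [d2 [Hd2 Hr2]]; [now exists (dr T)|tauto|].
  assert (Hext : forall s, tau <= s < T + Rmin d1 d2 -> 0 < p s /\ 0 < r s).
  { intros s Hs. pose proof (Rmin_l d1 d2). pose proof (Rmin_r d1 d2).
    destruct (Rlt_or_le s T) as [Hlt|Hge]; [apply Hbelow; lra|].
    split; [apply Hp1|apply Hr2]; rewrite Rabs_pos_eq; lra. }
  assert (Hdm : 0 < Rmin d1 d2) by now apply Rmin_pos.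
  intros s Hs. apply Hext. split; [lra|].
  destruct (Rlt_or_le b (T + Rmin d1 d2)) as [Hlt|Hge]; [lra|].
  exfalso. assert (T + Rmin d1 d2 / 2 <= T); [|lra].
  apply Hub. split; [lra|]. intros s' Hs'. apply Hext. lra.
Qed.

(** The losses [A p r], [B r^2] and [-C s p r] leave
    [(p r)' >= r^2/2 - 2 C s p r + c s p^2].  Subtracting [s p r] and completing
    the square with [r - (2 C + 1) s p] leaves a multiple of [s p^2] that is
    nonnegative exactly under the last smallness condition on [s]. *)
Lemma saddle_product_rate (s p r A B dr c C : R) :
  0 < p -> 0 < r -> 0 < s ->
  Rabs A <= C * s -> Rabs B <= C * s ->
  c * s * p - C * s * r <= dr ->
  C * s <= 1 / 2 -> (2 * C + 1) ^ 2 * s <= 2 * c ->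
  s * (p * r) <= (r + A * p + B * r) * r + p * dr.
Proof.
  intros Hp Hr Hs HA HB Hdr Hs1 Hs2.
  apply Rabs_le_between in HA, HB.
  assert (H1 : - (C * s) * (p * r) <= A * (p * r)).
  { apply Rmult_le_compat_r; [left; now apply Rmult_lt_0_compat|lra]. }
  assert (H2 : - (1 / 2) * (r * r) <= B * (r * r)).
  { apply Rmult_le_compat_r; [left; now apply Rmult_lt_0_compat|lra]. }
  assert (H3 : p * (c * s * p - C * s * r) <= p * dr).
  { apply Rmult_le_compat_l; lra. }
  assert (H4 : 0 <= (r - (2 * C + 1) * s * p) ^ 2) by apply pow2_ge_0.
  assert (H5 : 0 <= (2 * c - (2 * C + 1) ^ 2 * s) * (s * p ^ 2)).
  { apply Rmult_le_pos; [lra|]. apply Rmult_le_pos; [lra|apply pow2_ge_0]. }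
  ring_simplify in H4. ring_simplify in H5. ring_simplify in H3.
  ring_simplify in H1. ring_simplify in H2. ring_simplify. lra.
Qed.

Lemma Rpower_inv (t a : R) : 0 < t -> Rpower t a * Rpower t (- a) = 1.
Proof.
  intros Ht. rewrite <- Rpower_plus, Rplus_opp_r. now apply Rpower_O.
Qed.

Lemma Rpower_pos (t a : R) : 0 < Rpower t a.
Proof. apply exp_pos. Qed.

Lemma Rpower_neg_small (alpha e : R) :
  0 < alpha -> 0 < e ->
  exists T, 0 < T /\ forall t, T < t -> Rpower t (- alpha) < e.
Proof.
  intros Ha He. exists (Rpower e (- (1 / alpha))). split; [apply Rpower_pos|].
  intros t Ht.
  assert (Hlt : Rpower (Rpower e (- (1 / alpha))) alpha < Rpower t alpha).
  { apply Rlt_Rpower_l; [exact Ha|]. split; [apply Rpower_pos|exact Ht]. }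
  rewrite Rpower_mult in Hlt.
  replace (- (1 / alpha) * alpha) with (- (1)) in Hlt by (field; lra).
  rewrite Rpower_Ropp, Rpower_1 in Hlt by exact He.
  rewrite Rpower_Ropp. rewrite <- (Rinv_inv e).
  apply Rinv_lt_contravar; [|exact Hlt].
  apply Rmult_lt_0_compat; [now apply Rinv_0_lt_compat|apply Rpower_pos].
Qed.

Lemma inv_le_Rpower_neg (alpha t : R) :
  alpha <= 1 -> 1 <= t -> / t <= Rpower t (- alpha).
Proof.
  intros Ha Ht. rewrite <- (Rpower_1 t) at 1 by lra. rewrite <- Rpower_Ropp.
  apply Rle_Rpower; lra.
Qed.

(** A perturbed saddle whose coupling decays like [t^(-alpha)] with [alpha <= 1]
    expels every trajectory of the open quadrant from every bounded set.  The
    restriction on [alpha] enters through [t^(-alpha) >= 1/t]. *)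
Lemma saddle_escape (alpha c C : R) :
  0 < alpha <= 1 -> 0 < c -> 0 < C ->
  exists T, 0 < T /\ forall (tau eps : R) (p r dp dr : R -> R),
    T < tau -> 0 < p tau -> 0 < r tau ->
    (forall t, tau <= t -> is_derive p t (dp t) /\ is_derive r t (dr t)) ->
    (forall t, tau <= t -> 0 < p t -> 0 < r t ->
       exists A B, dp t = r t + A * p t + B * r t /\
         Rabs A <= C * Rpower t (- alpha) /\ Rabs B <= C * Rpower t (- alpha) /\
         c * Rpower t (- alpha) * p t - C * Rpower t (- alpha) * r t <= dr t) ->
    ~ (forall t, tau <= t -> Rabs (p t) <= eps /\ Rabs (r t) <= eps).
Proof.
  intros Ha Hc HC.
  assert (Hsq : 0 < (2 * C + 1) ^ 2) by (apply pow_lt; lra).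
  assert (He1 : 0 < 1 / (2 * C)) by (apply Rdiv_lt_0_compat; lra).
  assert (He2 : 0 < 2 * c / (2 * C + 1) ^ 2) by (apply Rdiv_lt_0_compat; lra).
  destruct (Rpower_neg_small alpha _ (proj1 Ha) He1) as [T1 [HT1 Hs1]].
  destruct (Rpower_neg_small alpha _ (proj1 Ha) He2) as [T2 [HT2 Hs2]].
  exists (T1 + T2 + 1). split; [lra|].
  intros tau eps p r dp dr Htau Hp Hr Hder Hsys Hbound.
  assert (Hgrow : forall t, tau <= t -> p tau * r tau / tau <= p t * r t / t).
  { apply (chetaev_growth p r dp dr tau); try assumption; [lra|].
    intros t Ht Hpt Hrt.
    destruct (Hsys t Ht Hpt Hrt) as [A [B [-> [HA [HB Hdr]]]]].
    apply Rle_trans with (Rpower t (- alpha) * (p t * r t)).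
    - unfold Rdiv. rewrite Rmult_comm.
      apply Rmult_le_compat_r; [left; now apply Rmult_lt_0_compat|].
      apply inv_le_Rpower_neg; lra.
    - apply saddle_product_rate with (c := c) (C := C); try assumption.
      + apply Rpower_pos.
      + replace (1 / 2) with (C * (1 / (2 * C))) by (field; lra).
        apply Rmult_le_compat_l; [lra|]. left. apply Hs1. lra.
      + replace (2 * c) with ((2 * C + 1) ^ 2 * (2 * c / (2 * C + 1) ^ 2))
          by (field; lra).
        apply Rmult_le_compat_l; [lra|]. left. apply Hs2. lra. }
  set (K := p tau * r tau / tau) in *.
  assert (HK : 0 < K).
  { apply Rdiv_lt_0_compat; [now apply Rmult_lt_0_compat|lra]. }
  pose proof (pow2_ge_0 eps) as Heps.
  assert (HepsK : 0 <= eps ^ 2 / K).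
  { apply Rmult_le_pos; [exact Heps|]. left. now apply Rinv_0_lt_compat. }
  (* [p r >= K t], which exceeds [eps^2] at this time. *)
  set (t := tau + eps ^ 2 / K).
  assert (Ht : tau <= t) by (unfold t; lra).
  specialize (Hgrow t Ht). destruct (Hbound t Ht) as [Hpt Hrt].
  assert (Hprod : p t * r t <= eps ^ 2).
  { eapply Rle_trans; [apply Rle_abs|]. rewrite Rabs_mult.
    replace (eps ^ 2) with (eps * eps) by ring.
    apply Rmult_le_compat; auto using Rabs_pos. }
  assert (Hlow : K * t <= p t * r t).
  { replace (p t * r t) with (p t * r t / t * t) by (field; lra).
    apply Rmult_le_compat_r; lra. }
  assert (Hval : K * t = K * tau + eps ^ 2) by (unfold t; field; lra).
  assert (0 < K * tau) by (apply Rmult_lt_0_compat; lra). lra.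
Qed.

(** * Leading order of the expansions *)

Lemma leading_term (q n : nat) (f : R -> R -> R -> R) (fk : nat -> R -> R -> R) :
  (1 <= n)%nat -> loc_unif_power_expansion q f fk ->
  (forall k x y, (1 <= k < n)%nat -> fk k x y = 0) ->
  continuity_2d_pt (fk n) 0 0 ->
  forall eta, 0 < eta ->
  exists rho T, 0 < rho /\ 0 < T /\
    forall x y t, Rabs x <= rho -> Rabs y <= rho -> T < t ->
      Rabs (Rpower t (INR n / INR q) * f x y t - fk n 0 0) <= eta.
Proof.
  intros Hn Hexp Hz Hcont eta Heta.
  assert (Heta2 : 0 < eta / 2) by lra.
  destruct (Hcont (mkposreal _ Heta2)) as [d Hd]. simpl in Hd.
  pose proof (cond_pos d) as Hdpos.
  destruct (Hexp n (d / 2) (eta / 2) Heta2) as [T [HT HTb]].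
  exists (d / 2), T. split; [lra|]. split; [exact HT|].
  intros x y t Hx Hy Ht.
  specialize (HTb x y t Hx Hy Ht).
  assert (Hsum : sum_n_m (fun k => Rpower t (- (INR k / INR q)) * fk k x y) 1 n
                 = Rpower t (- (INR n / INR q)) * fk n x y).
  { destruct n as [|n']; [lia|].
    rewrite sum_n_Sm by lia.
    rewrite (sum_n_m_ext_loc _ (fun _ => zero)).
    - rewrite sum_n_m_const_zero. apply plus_zero_l.
    - intros k Hk. rewrite Hz by lia. apply Rmult_0_r. }
  rewrite Hsum in HTb.
  assert (Hinv : Rpower t (INR n / INR q) * Rpower t (- (INR n / INR q)) = 1).
  { apply Rpower_inv. lra. }
  assert (Hc : Rabs (fk n x y - fk n 0 0) < eta / 2)
    by (apply Hd; rewrite Rminus_0_r; lra).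
  replace (Rpower t (INR n / INR q) * f x y t - fk n 0 0) with
    (Rpower t (INR n / INR q) * (f x y t - Rpower t (- (INR n / INR q)) * fk n x y)
     + (fk n x y - fk n 0 0))
    by (rewrite Rmult_minus_distr_l, <- Rmult_assoc, Hinv; ring).
  eapply Rle_trans; [apply Rabs_triang|]. lra.
Qed.

(** Differences of a perturbation between two points of a small box.  They are
    controlled by its first derivatives through the mean value theorem, applied
    first in [x] and then in [y]; this is where the expansions are needed in the
    C^1 sense.  By continuity of the leading coefficients, the slopes are those at
    the origin up to [eta] on a box whose size does not depend on [t]. *)
Lemma leading_increment (q n : nat) (f : R -> R -> R -> R) (fk : nat -> R -> R -> R) :
  (1 <= n)%nat -> smooth3_on (fun _ _ t => 0 < t) f ->
  C1_power_expansion q f fk ->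
  (forall k x y, (1 <= k < n)%nat -> fk k x y = 0) ->
  smooth2 (fk n) ->
  forall eta, 0 < eta ->
  exists rho T, 0 < rho /\ 0 < T /\
    forall X Y x y t, Rabs X <= rho -> Rabs Y <= rho ->
      Rabs x <= rho -> Rabs y <= rho -> T < t ->
      exists A B, f X Y t - f x y t = A * (X - x) + B * (Y - y) /\
        Rabs (Rpower t (INR n / INR q) * A - partial_x (fk n) 0 0) <= eta /\
        Rabs (Rpower t (INR n / INR q) * B - partial_y (fk n) 0 0) <= eta.
Proof.
  intros Hn Hsm [_ [Hex Hey]] Hz Hsmk eta Heta.
  (* Continuity at the origin of both first derivatives of [fk n]. *)
  destruct (Hsmk 1%nat 0 0) as [_ [_ [_ [[Hcx _] [Hcy _]]]]].
  destruct (leading_term q n _ _ Hn Hex) with (eta := eta)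
    as [rho1 [T1 [Hrho1 [HT1 H1]]]]; [|exact Hcx|exact Heta|].
  { intros k x y Hk. unfold partial_x.
    rewrite (Derive_ext _ (fun _ => 0)) by (intros u; now apply Hz).
    apply Derive_const. }
  destruct (leading_term q n _ _ Hn Hey) with (eta := eta)
    as [rho2 [T2 [Hrho2 [HT2 H2]]]]; [|exact Hcy|exact Heta|].
  { intros k x y Hk. unfold partial_y.
    rewrite (Derive_ext _ (fun _ => 0)) by (intros u; now apply Hz).
    apply Derive_const. }
  exists (Rmin rho1 rho2), (Rmax T1 T2).
  pose proof (Rmin_l rho1 rho2). pose proof (Rmin_r rho1 rho2).
  pose proof (Rmax_l T1 T2). pose proof (Rmax_r T1 T2).
  split; [now apply Rmin_pos|]. split; [lra|].
  intros X Y x y t HX HY Hx Hy Ht.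
  destruct (Hsm 1%nat) as [_ [Hd _]].
  destruct (mean_value (fun u => f u Y t) (fun u => partial1 f u Y t) x X)
    as [c1 [Hc1 E1]].
  { intros u _. apply Derive_correct. apply (Hd u Y t). lra. }
  destruct (mean_value (fun u => f x u t) (fun u => partial2 f x u t) y Y)
    as [c2 [Hc2 E2]].
  { intros u _. apply Derive_correct. apply (Hd x u t). lra. }
  assert (Rabs c1 <= Rmin rho1 rho2) by (now apply (between_abs_le x X)).
  assert (Rabs c2 <= Rmin rho1 rho2) by (now apply (between_abs_le y Y)).
  exists (partial1 f c1 Y t), (partial2 f x c2 t).
  split; [lra|]. split; [apply H1|apply H2]; lra.
Qed.

Lemma expansion_leading (q n : nat) (f : R -> R) (a : nat -> R) :
  (1 <= n)%nat -> (1 <= q)%nat -> power_expansion q n f a ->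
  forall e, 0 < e ->
  exists T, 0 < T /\ forall t, T < t ->
    Rabs (Rpower t (INR n / INR q) * f t - a n) < e /\ Rabs (f t) < e.
Proof.
  intros Hn Hq Hexp e He.
  assert (Hal : 0 < INR n / INR q)
    by (apply Rdiv_lt_0_compat; apply lt_0_INR; lia).
  set (al := INR n / INR q) in *.
  pose proof (Rabs_pos (a n)) as Ha.
  assert (He' : 0 < e / (Rabs (a n) + e)) by (apply Rdiv_lt_0_compat; lra).
  destruct (proj2 (is_lim_spec _ _ _) (Hexp n) (mkposreal e He)) as [T1 HT1].
  destruct (Rpower_neg_small al _ Hal He') as [T2 [HT2 Hs]].
  exists (Rmax T1 T2). pose proof (Rmax_l T1 T2). pose proof (Rmax_r T1 T2).
  split; [lra|]. intros t Ht.
  specialize (HT1 t). simpl in HT1. rewrite sum_n_n in HT1.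
  fold al in HT1. specialize (Hs t).
  pose proof (Rpower_inv t al) as Hinv. pose proof (Rpower_pos t (- al)) as Hspos.
  assert (Hlead : Rabs (Rpower t al * f t - a n) < e).
  { replace (Rpower t al * f t - a n) with
      (Rpower t al * (f t - Rpower t (- al) * a n) - 0); [apply HT1; lra|].
    rewrite Rmult_minus_distr_l, <- Rmult_assoc, Hinv by lra. ring. }
  split; [exact Hlead|].
  replace (f t) with (Rpower t (- al) * (Rpower t al * f t))
    by (rewrite <- Rmult_assoc, (Rmult_comm (Rpower t (- al))), Hinv by lra; ring).
  rewrite Rabs_mult, (Rabs_pos_eq (Rpower t (- al))) by lra.
  assert (Hle : Rabs (Rpower t al * f t) <= Rabs (a n) + e).
  { pose proof (Rabs_triang (Rpower t al * f t - a n) (a n)) as Htri.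
    replace (Rpower t al * f t - a n + a n) with (Rpower t al * f t) in Htri by ring.
    lra. }
  apply Rle_lt_trans with (Rpower t (- al) * (Rabs (a n) + e)).
  - apply Rmult_le_compat_l; lra.
  - replace e with (e / (Rabs (a n) + e) * (Rabs (a n) + e)) at 2 by (field; lra).
    apply Rmult_lt_compat_r; [lra|]. apply Hs. lra.
Qed.

(** * The potential force *)

Lemma lipschitz_near (f df : R -> R) :
  (forall x, is_derive f x (df x)) -> continuous df 0 ->
  exists M rho, 0 < M /\ 0 < rho /\
    forall X Y, Rabs X <= rho -> Rabs Y <= rho ->
      Rabs (f X - f Y) <= M * Rabs (X - Y).
Proof.
  intros Hd Hc.
  destruct (proj1 (filterlim_locally df (df 0)) Hc (mkposreal 1 Rlt_0_1))
    as [d Hdel].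
  pose proof (cond_pos d) as Hdpos. pose proof (Rabs_pos (df 0)).
  exists (Rabs (df 0) + 1), (d / 2). split; [lra|]. split; [lra|].
  intros X Y HX HY.
  destruct (mean_value f df Y X) as [c [Hcb ->]]; [intros u _; apply Hd|].
  assert (Hcr : Rabs c <= d / 2) by now apply (between_abs_le Y X).
  rewrite Rabs_mult. apply Rmult_le_compat_r; [apply Rabs_pos|].
  assert (Hcl : Rabs (df c - df 0) < 1).
  { apply (Hdel c). change (Rabs (c - 0) < d).
    rewrite Rminus_0_r. lra. }
  pose proof (Rabs_triang (df c - df 0) (df 0)).
  replace (df c - df 0 + df 0) with (df c) in * by ring. lra.
Qed.

Lemma hamiltonian_partials (H : R -> R -> R -> R) (V : R -> R -> R) (w : R -> R) :
  (forall x y lam : R, H x y lam = y ^ 2 / 2 + V x lam) ->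
  (forall x lam : R,
     is_derive (fun u => V u lam) x ((x ^ 2 - lam) * w x)) ->
  forall x y lam,
    partial1 H x y lam = (x ^ 2 - lam) * w x /\ partial2 H x y lam = y.
Proof.
  intros HH HV x y lam. split.
  - unfold partial1.
    rewrite (Derive_ext _ (fun u => y ^ 2 / 2 + V u lam)) by (intros; apply HH).
    rewrite Derive_plus;
      [|apply ex_derive_const|eexists; apply HV].
    replace (Derive (fun u => V u lam) x) with ((x ^ 2 - lam) * w x)
      by (symmetry; apply is_derive_unique, HV).
    rewrite Derive_const. ring.
  - unfold partial2.
    rewrite (Derive_ext _ (fun u => u ^ 2 / 2 + V x lam)) by (intros; apply HH).
    apply is_derive_unique. auto_derive; [exact I|field].
Qed.

(** The weight [w] cannot be recovered at [0] from the force [x^2 w(x)] of the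
    limiting system alone, but for the parameter value [-1] the force is
    [(x^2 + 1) w(x)], whose first factor never vanishes; thus [w] inherits the
    smoothness of the Hamiltonian. *)
Lemma weight_C1 (H : R -> R -> R -> R) (w : R -> R) :
  smooth3_on (fun _ _ _ => True) H ->
  (forall x y lam, partial1 H x y lam = (x ^ 2 - lam) * w x) ->
  exists dw, (forall x, is_derive w x (dw x)) /\ continuous dw 0.
Proof.
  intros Hsm Hw.
  destruct (Hsm 2%nat) as [_ [_ [[_ [Hd [[Hc _] _]]] _]]].
  set (h := fun x => partial1 H x 0 (-1)).
  set (h1 := fun x => partial1 (partial1 H) x 0 (-1)).
  assert (Hh : forall x, is_derive h x (h1 x)).
  { intros x. apply Derive_correct. apply (Hd x 0 (-1) I). }
  assert (Hh1 : continuous h1 0).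
  { apply (continuous_comp (fun x : R => ((x, 0), -1))
      (fun s : R * R * R => partial1 (partial1 H) (fst (fst s)) (snd (fst s)) (snd s))).
    - intros P [d HPd]. exists d. intros x Hx. apply HPd.
      repeat split; try exact Hx; apply ball_center.
    - now apply Hc. }
  assert (Hden : forall x : R, x ^ 2 + 1 <> 0)
    by (intros x; pose proof (pow2_ge_0 x); lra).
  assert (Hwh : forall x : R, h x / (x ^ 2 + 1) = w x)
    by (intros x; unfold h; rewrite Hw; field; apply Hden).
  exists (fun x => h1 x * / (x ^ 2 + 1) - h x * (2 * x / (x ^ 2 + 1) ^ 2)).
  split.
  - intros x.
    apply (is_derive_ext (fun x => h x / (x ^ 2 + 1)) w x _ Hwh).
    replace (h1 x * / (x ^ 2 + 1) - h x * (2 * x / (x ^ 2 + 1) ^ 2)) with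
      ((h1 x * (x ^ 2 + 1) - h x * (2 * x)) / (x ^ 2 + 1) ^ 2)
      by (pose proof (Hden x); set (D := x ^ 2 + 1) in *; field; assumption).
    apply (is_derive_div h (fun x => x ^ 2 + 1) x (h1 x) (2 * x));
      [apply Hh| |apply Hden].
    auto_derive; [exact I|ring].
  - apply (continuous_minus (fun x => h1 x * / (x ^ 2 + 1))
             (fun x => h x * (2 * x / (x ^ 2 + 1) ^ 2))).
    + apply (continuous_mult h1 (fun x => / (x ^ 2 + 1)) 0 Hh1).
      apply (ex_derive_continuous (fun x => / (x ^ 2 + 1))).
      auto_derive. apply Hden.
    + apply (continuous_mult h (fun x => 2 * x / (x ^ 2 + 1) ^ 2)).
      * apply (ex_derive_continuous h). now exists (h1 0).
      * apply (ex_derive_continuous (fun x => 2 * x / (x ^ 2 + 1) ^ 2)).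
        auto_derive. exact (pow_nonzero (0 ^ 2 + 1) 2 (Hden 0)).
Qed.

(** The force is almost linear with slope [2 w(0) X] between [X] and a point [Y]
    on its left, from above and on a box of fixed size, because
    [X^2 w(X) - Y^2 w(Y) = (X^2 - Y^2) w(Y) + X^2 (w(X) - w(Y))] with
    [X^2 - Y^2 = (X - Y) (2 X - (X - Y))]: the quadratic part [-(X - Y)^2 w(Y)] is
    nonpositive and may be dropped.  After multiplication by
    [sigma], what is left is [sigma X (2 w(Y) + M X)], a product close to
    [2 w(0) nu]. *)
Lemma force_increment (w : R -> R) (M rho0 nu : R) :
  0 < w 0 -> 0 < M -> 0 < rho0 ->
  (forall X Y, Rabs X <= rho0 -> Rabs Y <= rho0 ->
     Rabs (w X - w Y) <= M * Rabs (X - Y)) ->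
  forall eta, 0 < eta ->
  exists rho, 0 < rho /\
    forall X Y sigma, 0 < sigma -> Rabs X <= rho -> Rabs Y <= rho -> Y <= X ->
      Rabs (sigma * X - nu) < rho ->
      sigma * (X ^ 2 * w X - Y ^ 2 * w Y) <= (2 * w 0 * nu + eta) * (X - Y).
Proof.
  intros Hw0 HM Hrho0 Hlip eta Heta.
  assert (Hmul : continuity_2d_pt (fun a b => a * b) nu (2 * w 0)).
  { apply continuity_2d_pt_mult;
      [apply continuity_2d_pt_id1|apply continuity_2d_pt_id2]. }
  destruct (Hmul (mkposreal eta Heta)) as [d Hd]. simpl in Hd.
  pose proof (cond_pos d) as Hdpos.
  set (e := Rmin d (w 0)).
  assert (He : 0 < e) by now apply Rmin_pos.
  pose proof (Rmin_l d (w 0) : e <= d). pose proof (Rmin_r d (w 0) : e <= w 0).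
  assert (Hr1 : 0 < e / (4 * M)) by (apply Rdiv_lt_0_compat; lra).
  set (rho := Rmin (Rmin rho0 d) (e / (4 * M))).
  assert (Hrho : 0 < rho) by (repeat apply Rmin_pos; lra).
  assert (Hrho1 : rho <= rho0 /\ rho <= d /\ M * rho <= e / 4).
  { pose proof (Rmin_l (Rmin rho0 d) (e / (4 * M)) : rho <= _).
    pose proof (Rmin_r (Rmin rho0 d) (e / (4 * M)) : rho <= _).
    pose proof (Rmin_l rho0 d). pose proof (Rmin_r rho0 d).
    split; [lra|]. split; [lra|].
    replace (e / 4) with (M * (e / (4 * M))) by (field; lra).
    apply Rmult_le_compat_l; lra. }
  exists rho. split; [exact Hrho|].
  intros X Y sigma Hsig HX HY HYX Hnu.
  assert (HwY : Rabs (w Y - w 0) <= e / 4).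
  { eapply Rle_trans; [apply Hlip; rewrite ?Rabs_R0; lra|].
    rewrite Rminus_0_r. apply Rle_trans with (M * rho); [|lra].
    apply Rmult_le_compat_l; lra. }
  assert (HwXY : w X - w Y <= M * (X - Y)).
  { eapply Rle_trans; [apply Rle_abs|].
    rewrite <- (Rabs_pos_eq (X - Y)) by lra. apply Hlip; lra. }
  assert (HMX : Rabs (M * X) <= e / 4).
  { rewrite Rabs_mult, (Rabs_pos_eq M) by lra.
    apply Rle_trans with (M * rho); [|lra]. apply Rmult_le_compat_l; lra. }
  apply Rabs_le_between in HwY, HMX.
  assert (Hprod : Rabs (sigma * X * (2 * w Y + M * X) - nu * (2 * w 0)) < eta).
  { apply Hd; [lra|]. apply Rabs_lt_between. lra. }
  apply Rabs_lt_between in Hprod.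
  assert (H1 : X ^ 2 * w X - Y ^ 2 * w Y <= (X - Y) * (X * (2 * w Y + M * X))).
  { assert (H2 : 0 <= (X - Y) ^ 2 * w Y).
    { apply Rmult_le_pos; [apply pow2_ge_0|lra]. }
    assert (H3 : X ^ 2 * (w X - w Y) <= X ^ 2 * (M * (X - Y))).
    { apply Rmult_le_compat_l; [apply pow2_ge_0|lra]. }
    ring_simplify in H2. ring_simplify in H3. ring_simplify. lra. }
  apply Rle_trans with (sigma * ((X - Y) * (X * (2 * w Y + M * X)))).
  - apply Rmult_le_compat_l; lra.
  - replace (sigma * ((X - Y) * (X * (2 * w Y + M * X)))) with
      (sigma * X * (2 * w Y + M * X) * (X - Y)) by ring.
    apply Rmult_le_compat_r; lra.
Qed.

(** * Instability *)

Lemma scaled_bound (sigma s A a eta C : R) :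
  0 < s -> sigma * s = 1 -> Rabs (sigma * A - a) <= eta -> Rabs a + eta <= C ->
  Rabs A <= C * s.
Proof.
  intros Hs Hinv HA HC.
  replace A with (sigma * A * s)
    by (rewrite Rmult_assoc, (Rmult_comm A), <- Rmult_assoc, Hinv; ring).
  rewrite Rabs_mult, (Rabs_pos_eq s) by lra.
  apply Rmult_le_compat_r; [lra|].
  pose proof (Rabs_triang (sigma * A - a) a) as Htri.
  replace (sigma * A - a + a) with (sigma * A) in Htri by ring. lra.
Qed.

Lemma dist_euc_components (x y x' y' e : R) :
  dist_euc x y x' y' < e -> Rabs (x' - x) < e /\ Rabs (y' - y) < e.
Proof.
  unfold dist_euc. intros Hd.
  rewrite (Rabs_minus_sym x'), (Rabs_minus_sym y'), <- !sqrt_Rsqr_abs.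
  pose proof (Rle_0_sqr (x - x')). pose proof (Rle_0_sqr (y - y')).
  split; (eapply Rle_lt_trans; [|exact Hd]); apply sqrt_le_1_alt; lra.
Qed.

Lemma dist_euc_lt (x y h d : R) :
  0 < d -> Rabs h <= d / 2 -> dist_euc (x - h) (y - h) x y < d.
Proof.
  intros Hd Hh. unfold dist_euc, Rsqr. apply Rabs_le_between in Hh.
  rewrite <- (sqrt_square d) at 1 by lra.
  apply sqrt_lt_1_alt. nra.
Qed.

Theorem theorem6
  (H : R -> R -> R -> R) (V : R -> R -> R) (w : R -> R) (d0 : R)
  (F G : R -> R -> R -> R) (q : nat) (Fk Gk : nat -> R -> R -> R)
  (H_smooth : smooth3_on (fun _ _ _ => True) H)
  (F_smooth : smooth3_on (fun _ _ t => 0 < t) F)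
  (G_smooth : smooth3_on (fun _ _ t => 0 < t) G)
  (H_def : forall x y lam : R, H x y lam = y ^ 2 / 2 + V x lam)
  (V_deriv : forall x lam : R,
     is_derive (fun u => V u lam) x ((x ^ 2 - lam) * w x))
  (d0_pos : 0 < d0)
  (w_pos : forall x lam : R,
     (0 <= lam /\ Rabs x < sqrt lam + d0) \/ (lam < 0 /\ Rabs x < d0) ->
     0 < w x)
  (F_vanish : tends_to_zero_loc_unif F)
  (G_vanish : tends_to_zero_loc_unif G)
  (q_pos : (1 <= q)%nat)
  (Fk_smooth : forall k : nat, (1 <= k)%nat -> smooth2 (Fk k))
  (Gk_smooth : forall k : nat, (1 <= k)%nat -> smooth2 (Gk k))
  (F_expansion : C1_power_expansion q F Fk)
  (G_expansion : C1_power_expansion q G Gk)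
  (n : nat) (n_range : (1 <= n <= q)%nat)
  (Fk_zero : forall (i : nat) (x y : R), (1 <= i < n)%nat -> Fk i x y = 0)
  (Gk_zero : forall (i : nat) (x y : R), (1 <= i < n)%nat -> Gk i x y = 0)
  (Gk_origin : forall l : nat, (l < n)%nat -> Gk (n + l)%nat 0 0 = 0)
  (nondeg : Gk (2 * n)%nat 0 0
            - Fk n 0 0 * (partial_y (Gk n) 0 0 + kronecker n q) <> 0)
  (Delta_pos : 0 < Delta_n w q n Fk Gk)
  (t0 : R) (t0_pos : 0 < t0)
  (xs ys : R -> R)
  (sol : is_solution H 0 F G t0 xs ys)
  (xk yk : nat -> R)
  (xs_expansion : power_expansion q n xs xk)
  (ys_expansion : power_expansion q n ys yk)
  (xk_n : xk n = nu_minus w q n Fk Gk) :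
  lyapunov_unstable H 0 F G t0 xs ys.
Proof.
  pose proof (hamiltonian_partials H V w H_def V_deriv) as HP.
  assert (Hw0 : 0 < w 0).
  { apply (w_pos 0 0). left. rewrite sqrt_0, Rabs_R0. lra. }
  destruct (weight_C1 H w H_smooth) as [dw [Hdw Hdwc]]; [intros; apply HP|].
  destruct (lipschitz_near w dw Hdw Hdwc) as [M [rho0 [HM [Hrho0 Hlip]]]].
  set (kappa := sqrt (Delta_n w q n Fk Gk)).
  assert (Hk : 0 < kappa) by now apply sqrt_lt_R0.
  set (fx := partial_x (Fk n) 0 0). set (fy := partial_y (Fk n) 0 0).
  set (gx := partial_x (Gk n) 0 0). set (gy := partial_y (Gk n) 0 0).
  set (nu := nu_minus w q n Fk Gk).
  (* The choice of the root [nu_-]: this makes the coefficient of [p] in [r']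
     equal to [kappa s] at the leading order. *)
  assert (Hnu : 2 * w 0 * nu = gx - kappa).
  { unfold nu, nu_minus. fold gx kappa. field. lra. }
  destruct (leading_increment q n F Fk) with (eta := 1)
    as [rF [TF [HrF [HTF HF]]]]; try tauto; [apply Fk_smooth; lia|lra|].
  destruct (leading_increment q n G Gk) with (eta := kappa / 4)
    as [rG [TG [HrG [HTG HG]]]]; try tauto; [apply Gk_smooth; lia|lra|].
  destruct (force_increment w M rho0 nu Hw0 HM Hrho0 Hlip (kappa / 4))
    as [rW [HrW HW]]; [lra|].
  fold fx fy in HF. fold gx gy in HG.
  set (al := INR n / INR q) in *.
  assert (Hal : 0 < al <= 1).
  { assert (0 < INR n) by (apply lt_0_INR; lia).
    assert (INR n <= INR q) by (apply le_INR; lia).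
    split; [apply Rdiv_lt_0_compat; lra|].
    apply Rmult_le_reg_r with (INR q); [lra|].
    unfold al. field_simplify; lra. }
  set (C := Rabs fx + Rabs fy + Rabs gy + 1 + kappa).
  pose proof (Rabs_pos fx). pose proof (Rabs_pos fy). pose proof (Rabs_pos gy).
  destruct (saddle_escape al (kappa / 2) C Hal) as [TS [HTS Hescape]];
    [lra|unfold C; lra|].
  set (rho := Rmin rF (Rmin rG rW)).
  assert (Hrho : 0 < rho /\ rho <= rF /\ rho <= rG /\ rho <= rW).
  { pose proof (Rmin_l rF (Rmin rG rW) : rho <= _).
    pose proof (Rmin_r rF (Rmin rG rW) : rho <= _).
    pose proof (Rmin_l rG rW). pose proof (Rmin_r rG rW).
    split; [repeat apply Rmin_pos; assumption|lra]. }
  destruct (expansion_leading q n xs xk) with (e := rho / 2)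
    as [TX [HTX HX]]; try tauto; [lra|].
  destruct (expansion_leading q n ys yk) with (e := rho / 2)
    as [TY [HTY HY]]; try tauto; [lra|].
  fold al in HX, HY. rewrite xk_n in HX. fold nu in HX.
  intros Hstable.
  set (tau := t0 + TF + TG + TS + TX + TY).
  destruct (Hstable tau (rho / 2)) as [del [Hdel Hnear]]; [unfold tau; lra|lra|].
  (* The deviation starts in the open quadrant [p > 0, r > 0]. *)
  destruct (Hnear (xs tau - del / 2) (ys tau - del / 2))
    as [x [y [Hsol [Hx0 [Hy0 Hclose]]]]].
  { apply dist_euc_lt; [exact Hdel|]. rewrite Rabs_pos_eq; lra. }
  pose proof (fun t Ht => dist_euc_components _ _ _ _ _ (Hclose t Ht)) as Hcomp.
  apply (Hescape tau (rho / 2) (fun t => xs t - x t) (fun t => ys t - y t)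
    (fun t => (partial2 H (xs t) (ys t) 0 + F (xs t) (ys t) t)
              - (partial2 H (x t) (y t) 0 + F (x t) (y t) t))
    (fun t => (- partial1 H (xs t) (ys t) 0 + G (xs t) (ys t) t)
              - (- partial1 H (x t) (y t) 0 + G (x t) (y t) t))).
  - unfold tau; lra.
  - lra.
  - lra.
  - intros t Ht. assert (t0 <= t) by (unfold tau in Ht; lra).
    destruct (sol t) as [Hs1 Hs2]; [assumption|]. destruct (Hsol t Ht) as [Hs3 Hs4].
    split; [now apply (is_derive_minus xs x)|now apply (is_derive_minus ys y)].
  - intros t Ht Hp Hr. simpl.
    assert (Hlate : 0 < t /\ TF < t /\ TG < t /\ TX < t /\ TY < t)
      by (unfold tau in Ht; lra).
    destruct (HX t) as [HXnu HXs]; [tauto|]. destruct (HY t) as [_ HYs]; [tauto|].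
    destruct (Hcomp t Ht) as [Hcx Hcy].
    assert (Hbox : Rabs (x t) <= rho /\ Rabs (y t) <= rho).
    { apply Rabs_lt_between in Hcx, Hcy, HXs, HYs.
      split; apply Rabs_le_between; lra. }
    destruct (HF (xs t) (ys t) (x t) (y t) t) as [A [B [HFe [HA HB]]]]; try lra.
    destruct (HG (xs t) (ys t) (x t) (y t) t) as [A' [B' [HGe [HA' HB']]]]; try lra.
    pose proof (HW (xs t) (x t) (Rpower t al)) as Hforce.
    pose proof (Rpower_inv t al) as Hinv.
    pose proof (Rpower_pos t al) as Hsig. pose proof (Rpower_pos t (- al)) as Hs.
    assert (HAs : Rabs A <= C * Rpower t (- al)).
    { apply (scaled_bound (Rpower t al) _ A fx 1); unfold C; tauto || lra. }
    assert (HBs : Rabs B <= C * Rpower t (- al)).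
    { apply (scaled_bound (Rpower t al) _ B fy 1); unfold C; tauto || lra. }
    assert (HB's : Rabs B' <= C * Rpower t (- al)).
    { apply (scaled_bound (Rpower t al) _ B' gy (kappa / 4)); unfold C; tauto || lra. }
    exists A, B. split; [|split; [exact HAs|split; [exact HBs|]]].
    + destruct (HP (xs t) (ys t) 0) as [_ ->]. destruct (HP (x t) (y t) 0) as [_ ->].
      lra.
    + destruct (HP (xs t) (ys t) 0) as [-> _]. destruct (HP (x t) (y t) 0) as [-> _].
      rewrite !Rminus_0_r.
      set (p := xs t - x t) in *. set (r := ys t - y t) in *.
      set (sg := Rpower t al) in *. set (s := Rpower t (- al)) in *.
      set (fo := xs t ^ 2 * w (xs t) - x t ^ 2 * w (x t)) in *.
      assert (Hfo : sg * fo <= (2 * w 0 * nu + kappa / 4) * p)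
        by (apply Hforce; unfold p in Hp; lra).
      apply Rabs_le_between in HA', HB's.
      assert (HsA : (gx - kappa / 4) * p <= sg * A' * p)
        by (apply Rmult_le_compat_r; lra).
      assert (HsB : - (C * s) * r <= B' * r) by (apply Rmult_le_compat_r; lra).
      rewrite Hnu in Hfo.
      (* The errors [kappa/4] of the slope of [G] and of the force use up half
         of [kappa]. *)
      assert (Hmain : s * (kappa / 2 * p) <= s * (sg * (A' * p - fo)))
        by (apply Rmult_le_compat_l; lra).
      rewrite <- (Rmult_assoc s sg), (Rmult_comm s sg), Hinv in Hmain by tauto.
      unfold fo in Hmain. lra.
  - intros t Ht. destruct (Hcomp t Ht). lra.
Qed.
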